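(* Let $D>0$ and consider the system $$\dot x_1=-(1-u)x_2+u,\qquad \dot x_2=(1-u)x_1-\frac{D}{x_2},$$ with state $x=(x_1,x_2)\in\mathbb{R}^2_{>0}$ and scalar input $u$. Let $x_\star=(x_{1\star},x_{2\star})\in\mathbb{R}^2_{>0}$ be an assignable equilibrium, i.e. $x_{1\star}=\frac{D}{x_{2\star}}+D$. Then the zero dynamics of the system with respect to the output $x_1-x_{1\star}$ is unstable, and the zero dynamics with respect to the output $x_2-x_{2\star}$ is unstable. That is: $x_{2\star}$ is an unstable equilibrium of the zero dynamics (a scalar ODE for $x_2>0$) associated with the output $x_1-x_{1\star}$, and $x_{1\star}$ is an unstable equilibrium of the zero dynamics (a scalar ODE for $x_1>0$) associated with the output $x_2-x_{2\star}$.
   Context: The system is the normalized average model of a DC-DC buck-boost converter with a constant power load; a dot denotes the derivative with respect to normalized time. The set of assignable equilibria is $\mathcal{E}_x=\{x\in\mathbb{R}^2_{>0} : x_1-\frac{D}{x_2}-D=0\}$. Zero dynamics: for the output $x_i-x_{i\star}$ ($i\in\{1,2\}$), impose $x_i(t)\equiv x_{i\star}$ (hence $\dot x_i\equiv 0$), solve the $i$-th state equation for the unique input $u$ that maintains this constraint, and substitute this $u$ and $x_i=x_{i\star}$ into the other state equation. The resulting scalar autonomous ODE for the remaining state variable (taken on the positive half-line) is the zero dynamics with respect to that output. Instability is in the sense of Lyapunov. *)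

(* Defs.v *)
From Stdlib Require Import Reals.
From Coquelicot Require Import Coquelicot.
Open Scope R_scope.

(** * The normalized averaged model *)

Inductive coord := X1 | X2.

Definition other (i : coord) : coord := match i with X1 => X2 | X2 => X1 end.

Definition component (i : coord) (x : R * R) : R :=
  match i with X1 => fst x | X2 => snd x end.

(** Right-hand side of the i-th state equation, at state [x] and input [u]. *)
Definition buck_boost (D : R) (i : coord) (x : R * R) (u : R) : R :=
  match i with
  | X1 => - (1 - u) * snd x + u
  | X2 => (1 - u) * fst x - D / snd x
  end.

Definition assignable_equilibrium (D : R) (x : R * R) : Prop :=
  0 < fst x /\ 0 < snd x /\ fst x - D / snd x - D = 0.

(** * Zero dynamics *)

(** The state whose [i]-th component is [c] and whose other component is [z]. *)
Definition slice (i : coord) (c z : R) : R * R :=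
  match i with X1 => (c, z) | X2 => (z, c) end.

(** At every point of the constraint set [x_i = c], [alpha] gives the one and
    only input for which the [i]-th state equation reads [x_i' = 0]. *)
Definition zeroing_input (D : R) (i : coord) (c : R) (alpha : R -> R) : Prop :=
  forall z : R, 0 < z ->
  forall u : R, buck_boost D i (slice i c z) u = 0 <-> u = alpha z.

Definition zero_dynamics_field
    (D : R) (i : coord) (c : R) (alpha : R -> R) (z : R) : R :=
  buck_boost D (other i) (slice i c z) (alpha z).

(** * Lyapunov stability for a scalar ODE [z' = g z] on the open half-line *)

(** [z] solves the ODE on [0, T).  As [z] is a total function, asking for a
    two-sided derivative at time 0 is no restriction compared with a one-sided
    one: modify [z] to be affine at negative times. *)
Definition is_solution (g : R -> R) (T : R) (z : R -> R) : Prop :=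
  forall t : R, 0 <= t < T -> 0 < z t /\ is_derive z t (g (z t)).

(** All local solutions are considered, so no global existence is presupposed
    and a solution leaving the half-line in finite time violates stability. *)
Definition lyapunov_stable (g : R -> R) (zs : R) : Prop :=
  forall eps : R, 0 < eps ->
  exists delta : R, 0 < delta /\
    forall (T : R) (z : R -> R),
      is_solution g T z ->
      Rabs (z 0 - zs) < delta ->
      forall t : R, 0 <= t < T -> Rabs (z t - zs) < eps.

Definition unstable_equilibrium (g : R -> R) (zs : R) : Prop :=
  0 < zs /\ g zs = 0 /\ ~ lyapunov_stable g zs.

(** The field of the zero dynamics is determined on the half-line by
    [zeroing_input], and [unstable_equilibrium] only depends on it there, so
    the existential amounts to well-definedness of the zero dynamics. *)
Definition zero_dynamics_unstable (D : R) (xs : R * R) (i : coord) : Prop :=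
  exists alpha : R -> R,
    zeroing_input D i (component i xs) alpha /\
    unstable_equilibrium
      (zero_dynamics_field D i (component i xs) alpha)
      (component (other i) xs).

(* Main.v *)
Require Import Defs.
From Stdlib Require Import Reals Lra Ranalysis5.
From Coquelicot Require Import Coquelicot.
Open Scope R_scope.

(** In both cases the zero dynamics has the form [z' = (z - zs) / h z] with [h]
    positive on the half-line, so the field is positive to the right of [zs].
    Separation of variables then gives, from every initial state [z0 > zs], a
    solution that reaches any prescribed [z1 > z0] in finite time. *)

Lemma antiderivative_above (f : R -> R) (a z0 : R) :
  a < z0 ->
  (forall z, a < z -> continuous f z) ->
  forall z, a < z -> is_derive (fun y => RInt f z0 y) z (f z).
Proof.
  intros Hz0 Hf z Hz.
  apply (is_derive_RInt f (fun y => RInt f z0 y) z0 z); [|now apply Hf].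
  (* The radius [z - a] keeps the upper limit [y] above [a], so the whole segment between [z0] and
     [y] lies where [f] is continuous. *)
  assert (He : 0 < z - a) by lra.
  exists (mkposreal _ He); intros y Hy.
  apply Rabs_lt_between in Hy; unfold minus, plus, opp in Hy; simpl in Hy.
  apply (RInt_correct (V := R_CompleteNormedModule)).
  apply (ex_RInt_continuous (V := R_CompleteNormedModule)).
  intros x [Hx _]; apply Hf.
  assert (a < Rmin z0 y) by (apply Rmin_glb_lt; lra).
  lra.
Qed.

(** Differentiating [F (z s) = s] forces this value; strict monotonicity of [F] supplies the
    continuity of [z] that makes the step legitimate. With [F' = / g] the conclusion is the ODE
    [z' = g z]. *)
Lemma is_derive_inverse (F F' z : R -> R) (lb ub t : R) :
  lb < ub ->
  (forall x, lb <= x <= ub -> is_derive F x (F' x)) ->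
  (forall x y, lb <= x -> x < y -> y <= ub -> F x < F y) ->
  (forall s, F lb <= s <= F ub -> lb <= z s <= ub /\ F (z s) = s) ->
  F lb < t < F ub ->
  F' (z t) <> 0 ->
  is_derive z t (/ F' (z t)).
Proof.
  intros Hlu HF Hincr Hz Ht Hne.
  assert (Hinv : forall s, F lb <= s -> s <= F ub -> comp F z s = id s)
    by (intros s H1 H2; now apply (Hz s)).
  assert (Hrange : forall s, F lb <= s -> s <= F ub -> lb <= z s <= ub)
    by (intros s H1 H2; apply Hz; lra).
  assert (Hleft := leftinv_is_rightinv_interv F z lb ub Hincr Hinv Hrange).
  unfold comp, id in Hleft.
  assert (HFd : forall x, lb <= x <= ub -> derivable_pt F x)
    by (intros x Hx; exists (F' x); now apply is_derive_Reals, HF).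
  assert (Hcont : continuity_pt z t).
  { apply (continuity_pt_recip_interv F z lb ub Hlu Hincr Hinv Hrange); auto.
    intros x Hx; now apply derivable_continuous_pt, HFd. }
  assert (HFlu : F lb < F ub) by (apply Hincr; lra).
  (* The inverse rule applied below states its domain through the endpoints [z (F lb)] and
     [z (F ub)], which [Hleft] identifies with [lb] and [ub]. *)
  assert (Prf : forall x, z (F lb) <= x <= z (F ub) -> derivable_pt F x)
    by (intros x; rewrite !Hleft by lra; apply HFd).
  assert (Hzt : z (F lb) <= z t <= z (F ub))
    by (rewrite !Hleft by lra; apply Hz; lra).
  assert (Hval : derive_pt F (z t) (Prf (z t) Hzt) = F' (z t)).
  { apply derive_pt_eq_0, is_derive_Reals, HF, Hz; lra. }
  apply is_derive_Reals.
  replace (/ F' (z t)) with (1 / derive_pt F (z t) (Prf (z t) Hzt))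
    by (rewrite Hval; unfold Rdiv; ring).
  apply (derivable_pt_lim_recip_interv F z (F lb) (F ub)); auto.
  - intros s [H1 H2]; now apply Hinv.
  - now rewrite Hval.
Qed.

(** [F y], the integral of [/ g] from [z0] to [y], is the time needed to travel from [z0] to [y];
    its inverse is the solution, and [z1] is reached at time [F z1]. *)
Lemma solution_through (g : R -> R) (a z0 z1 : R) :
  a < z0 < z1 ->
  (forall z, a < z -> continuous g z) ->
  (forall z, a < z -> 0 < g z) ->
  exists (T t1 : R) (z : R -> R),
    0 <= t1 < T /\ z 0 = z0 /\ z t1 = z1 /\
    forall t, 0 <= t < T -> a < z t /\ is_derive z t (g (z t)).
Proof.
  intros Hz Hcont Hpos.
  set (F := fun y => RInt (fun x => / g x) z0 y).
  assert (HF : forall x, a < x -> is_derive F x (/ g x)).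
  { apply antiderivative_above; [lra|]; intros x Hx.
    apply (continuous_comp g Rinv); [now apply Hcont|].
    apply continuity_pt_filterlim, continuity_pt_inv.
    - apply continuity_pt_id.
    - apply Rgt_not_eq, (Hpos x Hx). }
  assert (HF0 : F z0 = 0) by (apply (RInt_point (V := R_CompleteNormedModule))).
  assert (Hincr : forall x y, a < x -> x < y -> F x < F y).
  { intros x y Hx Hxy.
    apply (incr_function F a p_infty (fun x => / g x)); simpl; auto.
    intros w Hw _; apply Rinv_0_lt_compat; auto. }
  (* The margins on both sides put time 0 in the interior of the range of [F], as the two-sided
     derivative there requires, and leave [F z1] strictly before the final time [F ub]. *)
  set (lb := (a + z0) / 2); set (ub := z1 + 1).
  assert (Hlb : a < lb < z0) by (unfold lb; lra).
  assert (Hub : z1 < ub) by (unfold ub; lra).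
  assert (Hinv : forall t, {x | F lb <= t <= F ub -> lb <= x <= ub /\ F x = t}).
  { intros t.
    destruct (Rle_dec (F lb) t) as [H1|H1]; [|exists 0; lra].
    destruct (Rle_dec t (F ub)) as [H2|H2]; [|exists 0; lra].
    destruct (f_interv_is_interv F lb ub t) as [x Hx]; [lra|lra| |now exists x].
    intros x Hx; apply derivable_continuous_pt.
    exists (/ g x); apply is_derive_Reals, HF; lra. }
  set (z := fun t => proj1_sig (Hinv t)).
  assert (Hzt : forall t, F lb <= t <= F ub -> lb <= z t <= ub /\ F (z t) = t)
    by (intros t; exact (proj2_sig (Hinv t))).
  assert (HzF : forall x, lb <= x <= ub -> z (F x) = x).
  { apply (leftinv_is_rightinv_interv F z).
    - intros x y Hx Hxy _; apply Hincr; lra.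
    - intros s H1 H2; now apply (Hzt s).
    - intros s H1 H2; now apply (Hzt s). }
  assert (F lb < F z0) by (apply Hincr; lra).
  assert (F z0 < F z1) by (apply Hincr; lra).
  assert (F z1 < F ub) by (apply Hincr; lra).
  exists (F ub), (F z1), z.
  split; [|split; [|split; [|intros t Ht; split]]].
  - lra.
  - rewrite <- HF0; apply HzF; lra.
  - apply HzF; lra.
  - destruct (Hzt t); lra.
  - assert (Hgt : 0 < g (z t)) by (apply Hpos; destruct (Hzt t); lra).
    rewrite <- (Rinv_inv (g (z t))).
    apply (is_derive_inverse F (fun x => / g x) z lb ub t).
    + lra.
    + intros x Hx; apply HF; lra.
    + intros x y Hx Hxy _; apply Hincr; lra.
    + exact Hzt.
    + lra.
    + now apply Rgt_not_eq, Rinv_0_lt_compat.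
Qed.

Lemma unstable_of_positive_above (g : R -> R) (zs : R) :
  0 < zs ->
  g zs = 0 ->
  (forall z, zs < z -> continuous g z) ->
  (forall z, zs < z -> 0 < g z) ->
  unstable_equilibrium g zs.
Proof.
  intros Hzs H0 Hcont Hpos; repeat split; auto; intros Hst.
  destruct (Hst 1) as [delta [Hd Hsol]]; [lra|].
  (* The start [zs + m] is within [delta] of [zs] and still below [zs + 1], where the solution
     violates the bound for [eps = 1]. *)
  assert (Hm : 0 < Rmin (delta / 2) (1 / 2)) by (apply Rmin_glb_lt; lra).
  assert (Hm1 := Rmin_l (delta / 2) (1 / 2)).
  assert (Hm2 := Rmin_r (delta / 2) (1 / 2)).
  set (m := Rmin (delta / 2) (1 / 2)) in *.
  destruct (solution_through g zs (zs + m) (zs + 1))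
    as (T & t1 & z & Ht1 & Hz0 & Hz1 & Hz); [lra|auto|auto|].
  assert (Hlt : Rabs (z t1 - zs) < 1).
  { apply (Hsol T); auto.
    - intros t Ht; destruct (Hz t Ht); split; [lra|auto].
    - rewrite Hz0, Rabs_pos_eq; lra. }
  rewrite Hz1, Rabs_pos_eq in Hlt; lra.
Qed.

Lemma unstable_of_factorization (g k : R -> R) (zs : R) :
  0 < zs ->
  (forall z, 0 < z -> g z = (z - zs) * k z) ->
  (forall z, 0 < z -> ex_derive k z) ->
  (forall z, 0 < z -> 0 < k z) ->
  unstable_equilibrium g zs.
Proof.
  intros Hzs Hg Hk Hpos.
  apply unstable_of_positive_above; auto.
  - rewrite Hg by auto; ring.
  - intros z Hz.
    apply (ex_derive_continuous (V := R_NormedModule)).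
    (* The factorization holds only for positive arguments, so the two functions are compared on the
       ball of radius [z]. *)
    apply ex_derive_ext_loc with (fun z => (z - zs) * k z).
    + assert (He : 0 < z) by lra.
      exists (mkposreal _ He); intros y Hy.
      apply Rabs_lt_between in Hy; unfold minus, plus, opp in Hy; simpl in Hy.
      symmetry; apply Hg; lra.
    + auto_derive; apply Hk; lra.
  - intros z Hz; rewrite Hg by lra.
    apply Rmult_lt_0_compat; [lra|apply Hpos; lra].
Qed.

Theorem proposition2p1 (D : R) (xs : R * R)
    (HD : 0 < D) (Hxs : assignable_equilibrium D xs) :
  zero_dynamics_unstable D xs X1 /\ zero_dynamics_unstable D xs X2.
Proof.
  destruct xs as [x1 x2], Hxs as (H1 & H2 & He); simpl in *.
  assert (Hx1 : x1 = D / x2 + D) by lra.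
  split.
  - exists (fun z => z / (1 + z)); split; simpl.
    + intros z Hz u; simpl; split; intros Hu.
      * apply (Rmult_eq_reg_r (1 + z)); [|lra].
        field_simplify; lra.
      * subst u; field; lra.
    (* Here [1 - u = 1 / (1 + z)], and the field [x1 / (1 + z) - D / z] becomes [(z - x2)] times
       this factor once [x1 = D / x2 + D] is inserted. *)
    + apply unstable_of_factorization with (fun z => D / (x2 * z * (1 + z))); auto.
      * intros z Hz; unfold zero_dynamics_field; simpl.
        rewrite Hx1; field; lra.
      * intros z Hz; auto_derive.
        apply Rgt_not_eq; repeat apply Rmult_lt_0_compat; lra.
      * intros z Hz; apply Rdiv_lt_0_compat; [auto|].
        repeat apply Rmult_lt_0_compat; lra.
  - exists (fun z => 1 - D / (x2 * z)); split; simpl.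
    + intros z Hz u; simpl; split; intros Hu.
      * apply (Rmult_eq_reg_r z); [|lra].
        replace ((1 - D / (x2 * z)) * z) with (z - D / x2) by (field; lra).
        lra.
      * subst u; field; lra.
    (* Here [1 - u = D / (x2 * z)], so the field is [1 - (D + D / x2) / z = (z - x1) / z]. *)
    + apply unstable_of_factorization with (fun z => / z); auto.
      * intros z Hz; unfold zero_dynamics_field; simpl.
        rewrite Hx1; field; lra.
      * intros z Hz; auto_derive; lra.
      * intros z Hz; now apply Rinv_0_lt_compat.
Qed.
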